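(* Let $t\in\{3,4,5\}$, and let $k\ge 1$ and $c\ge 3$ be integers. Then $$\frac{t}{3}\,ck \;\le\; \gamma_{rt}(P(ck,k)) \;\le\; \frac{t}{3}\,(c+1)(k+1)-t,$$ and $\gamma_{rt}(P(ck,k))=\frac{t}{3}\,ck$ if and only if $c\equiv 0\pmod 6$ and $k$ is congruent to $1$ or $5$ modulo $6$.
   Context: For a finite simple graph $G$ and an integer $t\ge 1$, a $t$-rainbow domination function is a map $g$ assigning to each vertex $v$ a (possibly empty) subset $g(v)\subseteq\{1,2,\dots,t\}$ such that every vertex $v$ with $g(v)=\emptyset$ satisfies $\bigcup_{u\text{ neighbor of }v} g(u)=\{1,2,\dots,t\}$. Its weight is $w(g)=\sum_{v\in V(G)}|g(v)|$. The $t$-rainbow domination number $\gamma_{rt}(G)$ is the minimum weight over all $t$-rainbow domination functions of $G$. For $n\ge 3$ and $1\le k<\frac n2$, the generalized Petersen graph $P(n,k)$ is the graph on $2n$ vertices with vertex set $\{u_i,v_i \mid 0\le i\le n-1\}$ and edge set $\{u_iu_{i+1},\ u_iv_i,\ v_iv_{i+k}\mid 0\le i\le n-1\}$, subscripts taken modulo $n$. Here $n=ck$. *)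

(* Defs.v *)
From HB Require Import structures.
From mathcomp Require Import all_boot.

Set Implicit Arguments.
Unset Strict Implicit.
Unset Printing Implicit Defensive.

(* A simple graph on a finite vertex type [V] is given by its adjacency
   relation [e : rel V], expected to be symmetric and irreflexive. *)

(* The colour set {1, ..., t} is rendered as ['I_t] = {0, ..., t - 1}. *)
Definition rainbow_dom (V : finType) (e : rel V) (t : nat)
    (g : {ffun V -> {set 'I_t}}) : bool :=
  [forall v, (g v == set0) ==> (\bigcup_(u | e v u) g u == [set: 'I_t])].

Definition weight (V : finType) (t : nat) (g : {ffun V -> {set 'I_t}}) : nat :=
  \sum_v #|g v|.

Definition full_fun (V : finType) (t : nat) : {ffun V -> {set 'I_t}} :=
  [ffun=> [set: 'I_t]].

Lemma full_fun_rainbow_dom (V : finType) (e : rel V) (t : nat) :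
  rainbow_dom e (full_fun V t).
Proof.
apply/forallP => v; apply/implyP; rewrite ffunE => /eqP t0.
by rewrite -subTset t0 sub0set.
Qed.

(* The constant full function is only the witness [arg min] requires: it always
   satisfies [rainbow_dom], so this is the true minimum. *)
Definition rainbow_dom_number (V : finType) (e : rel V) (t : nat) : nat :=
  weight [arg min_(g < full_fun V t | rainbow_dom e g) weight g].

Lemma rainbow_dom_number_min (V : finType) (e : rel V) (t : nat) :
  (exists2 g : {ffun V -> {set 'I_t}},
     rainbow_dom e g & weight g = rainbow_dom_number e t) /\
  (forall g : {ffun V -> {set 'I_t}},
     rainbow_dom e g -> rainbow_dom_number e t <= weight g).
Proof.
rewrite /rainbow_dom_number; case: arg_minnP => [|g gP g_min].
  exact: full_fun_rainbow_dom.
by split; [exists g | exact: g_min].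
Qed.

(* Vertices of the generalized Petersen graph P(n, k): [inl i] is u_i and
   [inr i] is v_i. The arcs u_i u_(i+1), u_i v_i, v_i v_(i+k) are symmetrized
   to obtain the adjacency relation. *)
Definition petersen_arc (n k : nat) : rel ('I_n + 'I_n) :=
  fun x y =>
    match x, y with
    | inl i, inl j => (j : nat) == (i + 1) %% n
    | inl i, inr j => i == j
    | inr i, inr j => (j : nat) == (i + k) %% n
    | inr _, inl _ => false
    end.

Definition petersen (n k : nat) : rel ('I_n + 'I_n) :=
  fun x y => petersen_arc k x y || petersen_arc k y x.
Arguments petersen : clear implicits.

Lemma petersen_sym (n k : nat) : symmetric (petersen n k).
Proof. by move=> x y; rewrite /petersen orbC. Qed.

Lemma petersen_irr (n k : nat) :
  0 < k -> 2 * k < n -> irreflexive (petersen n k).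
Proof.
move=> k0 kn.
have shift_neq (i d : nat) : 0 < d -> d < n -> i < n -> (i == (i + d) %% n) = false.
  move=> d0 dn i_n; apply/negbTE; rewrite -{1}(modn_small i_n) -{1}[i]addn0.
  by rewrite eqn_modDl mod0n modn_small // eq_sym -lt0n.
have kn' : k < n by apply: leq_ltn_trans kn; rewrite leq_pmull.
have n1 : 1 < n by apply: leq_ltn_trans kn'.
by case=> i; rewrite /petersen /petersen_arc orbb shift_neq.
Qed.

(* Main.v *)
Require Import Defs.
From HB Require Import structures.
From mathcomp Require Import all_boot all_order all_algebra.
From mathcomp Require Import zify.
Import Order.TTheory GRing.Theory Num.Theory.

Set Implicit Arguments.
Unset Strict Implicit.
Unset Printing Implicit Defensive.

(** Lower bound and its equality case. The argument works on every cubic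
    graph, for t < 6. Give a vertex v the charge 6|g(v)| - t and let every
    nonempty vertex send a third of its charge to each empty neighbour. A
    nonempty vertex has positive charge and three neighbours, so it stays
    nonnegative; an empty vertex receives at least (6t - 3t)/3 = t from the
    neighbours that dominate it, which pays for its own -t. Hence
    6 w(g) >= t|V| ([cubic_lower]), that is w(g) >= tn/3 on P(n,k). Equality
    forces all these estimates to be tight: the empty and the nonempty vertices
    are the two classes of a bipartition, and each empty vertex sees every
    colour exactly once ([cubic_tight]).

    Equality on P(ck,k). Bipartiteness makes k odd and n = ck even, and at each
    index p exactly one of u_p, v_p is nonempty, alternately. For one fixed
    colour let S be the set of indices carrying it. Then S meets
    {p-1, p, p+1} once when u_p is empty and {p-k, p, p+k} once when v_p is
    empty. Writing indices as b + x + yk turns this into a condition on a planar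
    grid, alternately on horizontal and vertical triples, whose only solutions
    are the two families of diagonal stripes x + y or x - y constant modulo 3.
    In both of them S is invariant under p -> p + 3 ([perfect_code_step]).
    If 3 did not divide n, S would then contain two consecutive indices; if 3
    divided k, it would contain p and p + k; both are impossible
    ([perfect_code_arith]). So 6 divides c and k is prime to 6.

    Upper bound. Replacing the three colours of a 3-rainbow domination function
    by three blocks of a partition of {1,...,t}, and averaging over the three
    cyclic shifts of the blocks, gives 3 gamma_rt <= t gamma_r3
    ([rainbow_dom_number_scale]), so it suffices to show
    gamma_r3 <= (c+1)(k+1) - 3 = ck + (c + k - 2). Arrange the index i + jk at
    column i < k and row j < c. The stripes, colour i + j or i - j modulo 3,
    placed on u or on v according to the parity of i + j, cost ck and leave
    undominated only vertices on the boundary of the k x c rectangle, where the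
    pattern meets itself with a wrong parity or colour. Any assignment can be
    repaired by giving its missing colours to each undominated empty vertex
    ([rainbow_dom_number_repair]), so only the number of missing colours counts.
    Repairing the stripes alone may cost c + k, two too many, and three variants
    save them:
    - k prime to 6: with a suitable direction the stripes continue across the
      sides i = 0, k-1, and the repair costs at most k + 1, or nothing if 6
      divides c, which also gives the other half of the equality case;
    - k even or c odd: some cut edges join two empty vertices, and a single
      colour serves both when one end takes the colour that the other one lacks
      ([filled_cost]);
    - k odd multiple of 3 and c even: a second colour added to well-chosen
      vertices of row 0 serves two neighbours on different sides of the cut
      ([patched_cost]). *)

(** * Discharging on cubic graphs *)

Definition cubic (V : finType) (e : rel V) : Prop :=
  symmetric e /\ forall v, #|[pred u | e v u]| = 3.

Lemma empty_nbr_weight (V : finType) (e : rel V) (t : nat)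
    (g : {ffun V -> {set 'I_t}}) (v : V) :
  rainbow_dom e g -> g v = set0 -> t <= \sum_(u | e v u) #|g u|.
Proof.
move=> /forallP/(_ v)/implyP gP gv0.
have /eqP full := gP (introT eqP gv0).
rewrite -{1}(card_ord t) -cardsT -full.
elim/big_rec2: _ => [|u m A _ IH]; first by rewrite cards0.
by rewrite (leq_trans (leq_card_setU _ _)) // leq_add2l.
Qed.

(** Charges are multiplied by 3 to stay in [int]: this is the part of the final
    charge of a vertex of weight [f] that comes from its arc to a neighbour of
    weight [f']. A nonempty vertex splits its charge 6f - t equally among its
    three arcs and gives away the share of each arc to an empty vertex; an empty
    vertex counts on each arc a third of its threefold charge -3t, plus what it
    receives. *)
Definition arc_charge (t f f' : nat) : int :=
  if f == 0 then (if f' == 0 then - t%:Z else 6%:Z * f'%:Z - 2%:Z * t%:Z)%R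
  else (if f' == 0 then 0 else 6%:Z * f%:Z - t%:Z)%R.

Lemma arc_charge_sym (t f f' : nat) :
  (arc_charge t f f' + arc_charge t f' f =
   (6%:Z * f%:Z - t%:Z) + (6%:Z * f'%:Z - t%:Z))%R.
Proof. by rewrite /arc_charge; case: eqP; case: eqP; lia. Qed.

(** Discharging only moves charge along edges, so the total is that of the
    initial charges 6|g(v)| - t, three times over. *)
Lemma total_charge (V : finType) (e : rel V) (t : nat)
    (g : {ffun V -> {set 'I_t}}) :
  cubic e ->
  (\sum_v \sum_(u | e v u) arc_charge t #|g v| #|g u| =
   18%:Z * (weight g)%:Z - 3%:Z * (t * #|V|)%:Z)%R.
Proof.
case=> e_sym e3; set S := (LHS in LHS = _).
pose c v : int := (6%:Z * #|g v|%:Z - t%:Z)%R.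
have swap (F : V -> V -> int) :
    (\sum_v \sum_(u | e v u) F v u = \sum_v \sum_(u | e v u) F u v)%R.
  rewrite (exchange_big_dep predT) //=.
  by apply: eq_bigr => v _; apply: eq_bigl => u; rewrite e_sym.
have cE : (\sum_v \sum_(u | e v u) c v = 18%:Z * (weight g)%:Z - 3%:Z * (t * #|V|)%:Z)%R.
  transitivity (\sum_v (3%:Z * c v))%R.
    apply: eq_bigr => v _; rewrite sumr_const e3 -mulr_natl; congr (_ * _)%R.
  rewrite -mulr_sumr /c sumrB -mulr_sumr sumr_const /weight.
  rewrite -(big_morph Posz PoszD (erefl _)) -mulr_natl natz.
  by rewrite (_ : #|_| = #|V|) //; lia.
have dbl : (S + S = \sum_v \sum_(u | e v u) c v + \sum_v \sum_(u | e v u) c v)%R.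
  rewrite {2}/S swap {2}(swap (fun v _ => c v)) -!big_split /=.
  apply: eq_bigr => v _; rewrite -!big_split; apply: eq_bigr => u _ /=.
  exact: arc_charge_sym.
rewrite -cE; move: dbl; lia.
Qed.

(** For an empty vertex the worst case is that all three neighbours are
    nonempty, with total weight exactly t; this is where the constant 6 comes
    from. For a nonempty one, t < 6 makes the charge positive. *)
Lemma vertex_charge_ge0 (V : finType) (e : rel V) (t : nat)
    (g : {ffun V -> {set 'I_t}}) (v : V) :
  t < 6 -> cubic e -> rainbow_dom e g ->
  (0 <= \sum_(u | e v u) arc_charge t #|g v| #|g u|)%R.
Proof.
move=> t6 [_ e3] gP.
have [gv0|gv0] := eqVneq (g v) set0; last first.
  apply: sumr_ge0 => u _; rewrite /arc_charge cards_eq0 (negPf gv0).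
  by move: gv0; rewrite -card_gt0; case: eqP => //; lia.
have wt := empty_nbr_weight gP gv0.
have : (\sum_(u | e v u) (6%:Z * #|g u|%:Z - 2%:Z * t%:Z) <=
        \sum_(u | e v u) arc_charge t #|g v| #|g u|)%R.
  apply: ler_sum => u _; rewrite /arc_charge gv0 cards0 eqxx.
  by case: eqP; lia.
apply: le_trans; rewrite sumrB -mulr_sumr sumr_const e3.
by rewrite -(big_morph Posz PoszD (erefl _)); lia.
Qed.

Lemma cubic_lower (V : finType) (e : rel V) (t : nat)
    (g : {ffun V -> {set 'I_t}}) :
  t < 6 -> cubic e -> rainbow_dom e g -> t * #|V| <= 6 * weight g.
Proof.
move=> t6 e3 gP; have := total_charge g e3.
have : (0 <= \sum_v \sum_(u | e v u) arc_charge t #|g v| #|g u|)%R.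
  by apply: sumr_ge0 => v _; exact: vertex_charge_ge0.
lia.
Qed.

(** Equality makes every final charge vanish. A nonempty vertex keeps a positive
    share on any arc to a nonempty neighbour, so it has none; an empty vertex
    must have three nonempty neighbours of total weight t, and t colours covered
    with total multiplicity t are covered once each. *)
Lemma cubic_tight (V : finType) (e : rel V) (t : nat)
    (g : {ffun V -> {set 'I_t}}) :
  0 < t < 6 -> cubic e -> rainbow_dom e g ->
  6 * weight g = t * #|V| ->
  (forall v u, e v u -> (g u == set0) = (g v != set0)) /\
  (forall v x, g v = set0 -> \sum_(u | e v u) (x \in g u) = 1).
Proof.
case/andP=> t0 t6 e3 gP tight.
have chg0 v : (\sum_(u | e v u) arc_charge t #|g v| #|g u| = 0)%R.
  have /eqP := total_charge g e3.
  have -> : (18%:Z * (weight g)%:Z - 3%:Z * (t * #|V|)%:Z = 0)%R by lia.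
  rewrite psumr_eq0 => [/allP/(_ v)|w _]; last exact: vertex_charge_ge0.
  by rewrite mem_index_enum => /(_ isT)/eqP.
have wtE v : g v = set0 ->
    (forall u, e v u -> g u != set0) /\ \sum_(u | e v u) #|g u| = t.
  move=> gv0; have wt := empty_nbr_weight gP gv0.
  (* the weight bound compares sums term by term, so equality is termwise *)
  have lb u : (6%:Z * #|g u|%:Z - 2%:Z * t%:Z <= arc_charge t #|g v| #|g u|)%R.
    by rewrite /arc_charge gv0 cards0 eqxx; case: eqP; lia.
  have sumE : (\sum_(u | e v u) (6%:Z * #|g u|%:Z - 2%:Z * t%:Z) =
      6%:Z * (\sum_(u | e v u) #|g u|)%:Z - 6%:Z * t%:Z)%R.
    rewrite sumrB -mulr_sumr sumr_const e3.2.
    by rewrite -(big_morph Posz PoszD (erefl _)); lia.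
  have diff0 : (\sum_(u | e v u) (arc_charge t #|g v| #|g u| -
      (6%:Z * #|g u|%:Z - 2%:Z * t%:Z)) = 0)%R.
    apply/eqP; rewrite eq_le; apply/andP; split.
      by rewrite sumrB chg0 sumE; lia.
    by apply: sumr_ge0 => u _; rewrite subr_ge0.
  split; last by move: diff0; rewrite sumrB chg0 sumE; lia.
  move=> u evu; apply/negP => /eqP gu0.
  have diff_ge0 w : e v w -> (0 <= arc_charge t #|g v| #|g w| -
      (6%:Z * #|g w|%:Z - 2%:Z * t%:Z))%R by rewrite subr_ge0.
  have := psumr_eq0P diff_ge0 diff0 evu.
  by rewrite /arc_charge gv0 gu0 cards0 /=; lia.
split=> [v u evu|v x gv0].
  case: (eqVneq (g v) set0) => [/wtE[+ _]|gv0] /=.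
    by move/(_ u evu)/negPf.
  have fv : 0 < #|g v| by rewrite card_gt0.
  have chg_ge0 w : e v w -> (0 <= arc_charge t #|g v| #|g w|)%R.
    by rewrite /arc_charge; case: eqP; case: eqP; lia.
  have := psumr_eq0P chg_ge0 (chg0 v) evu.
  by rewrite /arc_charge -cards_eq0; case: eqP; case: eqP; lia.
have [_ sumE] := wtE v gv0.
pose cnt y := \sum_(u | e v u) (y \in g u).
have cnt_gt0 y : 1 <= cnt y.
  move/forallP/(_ v)/implyP: gP; rewrite gv0 eqxx => /(_ isT)/eqP full.
  have : y \in [set: 'I_t] by [].
  rewrite -full => /bigcupP[u evu yu].
  by rewrite /cnt (bigD1 u) //= yu.
have cntE : \sum_y cnt y = \sum_(y : 'I_t) 1.
  rewrite sum1_card card_ord -[RHS]sumE exchange_big /=.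
  apply: eq_bigr => u _; rewrite -sum1_card [RHS]big_mkcond.
  by apply: eq_bigr => y _; case: (_ \in _).
have /leqifP := leqif_sum (fun y (_ : true) => leqif_eq (cnt_gt0 y)).
by rewrite cntE ltnn; case: forallP => [/(_ x)/eqP cntx _|//]; rewrite -/(cnt x).
Qed.

(** * Neighbourhoods in generalized Petersen graphs *)

Lemma modn_lt_double (m n : nat) :
  m < n + n -> m %% n = if m < n then m else m - n.
Proof.
move=> mn; case: ltnP => [/modn_small //|nm].
by rewrite -{1}(subnK nm) modnDr modn_small // ltn_subLR.
Qed.

(** Both directions of a cyclic adjacency become translations: the predecessor at
    distance d is [shift (n - d)]. *)
Definition shift (n d : nat) (i : 'I_n) : 'I_n :=
  Ordinal (ltn_pmod (i + d) (leq_ltn_trans (leq0n i) (ltn_ord i))).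

Lemma shift_adj (n d : nat) (i j : 'I_n) :
  0 < d < n ->
  ((j == (i + d) %% n :> nat) = (j == shift d i)) *
  ((i == (j + d) %% n :> nat) = (j == shift (n - d) i)).
Proof.
case/andP=> d0 dn; split; first by rewrite -val_eqE.
rewrite -val_eqE /=; have ltin := ltn_ord i; have ltjn := ltn_ord j.
rewrite !modn_lt_double; try lia.
by case: ifP; case: ifP; lia.
Qed.

Lemma petersen_nbr_outer (n k : nat) (i : 'I_n) (x : 'I_n + 'I_n) :
  1 < n ->
  petersen n k (inl i) x =
  (x \in [:: inl (shift 1 i); inl (shift (n - 1) i); inr i]).
Proof.
move=> n1; rewrite /petersen; case: x => j; rewrite !inE /= !orbF.
  have d1 : 0 < 1 < n by rewrite n1.
  by rewrite !(shift_adj i j d1).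
exact: eq_sym.
Qed.

Lemma petersen_nbr_inner (n k : nat) (i : 'I_n) (x : 'I_n + 'I_n) :
  0 < k < n ->
  petersen n k (inr i) x =
  (x \in [:: inr (shift k i); inr (shift (n - k) i); inl i]).
Proof.
move=> kn; rewrite /petersen; case: x => j; rewrite !inE //= orbF.
by rewrite !(shift_adj i j kn).
Qed.

Lemma shift_neq (n d : nat) (i : 'I_n) :
  0 < d -> 2 * d < n -> shift d i != shift (n - d) i.
Proof.
move=> d0 dn; rewrite -val_eqE /=; have ltin := ltn_ord i.
rewrite !modn_lt_double; try lia.
by case: ifP; case: ifP; lia.
Qed.

Lemma petersen_big (R : Type) (idx : R) (op : Monoid.com_law idx)
    (n k : nat) (i : 'I_n) (F : 'I_n + 'I_n -> R) :
  0 < k -> 2 * k < n ->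
  (\big[op/idx]_(x | petersen n k (inl i) x) F x =
     op (op (F (inl (shift 1 i))) (F (inl (shift (n - 1) i)))) (F (inr i))) *
  (\big[op/idx]_(x | petersen n k (inr i) x) F x =
     op (op (F (inr (shift k i))) (F (inr (shift (n - k) i)))) (F (inl i))).
Proof.
move=> k0 kn.
have big3 (x y z : 'I_n + 'I_n) (P : pred ('I_n + 'I_n)) :
    uniq [:: x; y; z] -> P =i [:: x; y; z] ->
    \big[op/idx]_(w | P w) F w = op (op (F x) (F y)) (F z).
  move=> xyz PE; rewrite (eq_bigl _ _ PE) -big_uniq //.
  by rewrite !big_cons big_nil Monoid.mulm1 Monoid.mulmA.
split; apply: big3.
- by rewrite /= !inE !orbF -[inl _ == inl _]/(shift 1 i == _) shift_neq //; lia.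
- by move=> x; rewrite -(petersen_nbr_outer k) //; lia.
- by rewrite /= !inE !orbF -[inr _ == inr _]/(shift k i == _) shift_neq //; lia.
- by move=> x; rewrite -petersen_nbr_inner //; lia.
Qed.

Lemma petersen_cubic (n k : nat) :
  0 < k -> 2 * k < n -> cubic (petersen n k).
Proof.
move=> k0 kn; split; first exact: petersen_sym.
by case=> i; rewrite -sum1_card petersen_big.
Qed.

(** * Perfect colour classes *)

(** One colour class of a tight function in the coordinates (x, y) of the index
    b + x + yk, where alternately an outer vertex (horizontal triple) and an
    inner vertex (vertical triple) is empty; [e] is the parity of x + y at the
    left end of the horizontal triples. *)
Definition perfect_grid (F : nat -> nat -> bool) (e : bool) : Prop :=
  (forall x y, odd (x + y) = e -> F x y + F x.+1 y + F x.+2 y = 1) /\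
  (forall x y, odd (x + y) = ~~ e -> F x y + F x y.+1 + F x y.+2 = 1).

Lemma perfect_grid_swap (F : nat -> nat -> bool) (e : bool) :
  perfect_grid F e -> perfect_grid (fun x y => F y x) (~~ e).
Proof.
by case=> FH FV; split=> x y; rewrite addnC ?negbK => xy; [exact: FV|exact: FH].
Qed.

(** Around a point q = (x+3, y+1) of the class that is the centre of a vertical
    triple, all the values are determined by one bit: the class continues along
    q + (1,1), q - (1,1), q + (2,-1), or along the mirror images of these points.
    The equations that force this are those of the triples contained in the
    7 x 3 window around q. *)
Lemma perfect_grid_slope (F : nat -> nat -> bool) (e : bool) (x y : nat) :
  perfect_grid F e -> odd (x + y) = e -> F x.+3 y.+1 ->
  let A := F x.+4 y.+2 in
  [/\ F x.+2 y = A, F x.+4.+1 y = A & F x.+1 y.+2 = A] /\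
  [/\ F x.+4 y = ~~ A, F x.+2 y.+2 = ~~ A, F x.+4.+1 y.+2 = ~~ A &
      F x.+1 y = ~~ A].
Proof.
move=> [FH FV] xy Fq; rewrite -{}xy in FH FV *.
have := FH x y; have := FH x.+4 y; have := FH x y.+2; have := FH x.+4 y.+2.
have := FH x.+2 y; have := FH x.+2 y.+2; have := FV x.+1 y; have := FV x.+4.+1 y.
have := FH x.+1 y.+1; have := FH x.+3 y.+1; have := FV x.+3 y.
rewrite !(addSn, addnS) /= !negbK Fq.
move=> /(_ erefl) + /(_ erefl) + /(_ erefl).
case: (F x.+3 y) => //; case: (F x.+3 y.+2) => // _.
case: (F x.+4 y.+1) => //; case: (F x.+1.+4 y.+1) => // _.
case: (F x.+1 y.+1) => //; case: (F x.+2 y.+1) => // _.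
move=> /(_ erefl) + /(_ erefl) + /(_ erefl) + /(_ erefl).
case: (F x.+1.+4 y); case: (F x.+1.+4 y.+2) => // _;
case: (F x.+1 y); case: (F x.+1 y.+2) => // _;
case: (F x.+2 y.+2); case: (F x.+4 y.+2) => // _;
case: (F x.+2 y); case: (F x.+4 y) => // _;
by move=> /(_ erefl) + /(_ erefl) + /(_ erefl) + /(_ erefl);
   case: (F x.+2.+4 y.+2); case: (F x y.+2) => //;
   case: (F x.+2.+4 y); case: (F x y).
Qed.

(** The slope found at (4,4) persists along the stripe, and (7,4) lies on the
    same family of stripes for either slope. The point (4,4) and the step are
    chosen so that no coordinate used becomes negative. *)
Lemma perfect_grid_step (F : nat -> nat -> bool) (e : bool) :
  perfect_grid F e -> F 4 4 -> F 7 4.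
Proof.
(* swapping the axes exchanges the two kinds of points *)
move=> PF; have PF' := perfect_grid_swap PF; case: e PF PF' => PF PF' F44.
  have L x y := @perfect_grid_slope F true x y PF.
  have L' x y := @perfect_grid_slope _ false x y PF'.
  have [[_ _ F52] [_ F53 F56 _]] := L' 1 3 erefl F44.
  case F55: (F 5 5); rewrite F55 /= in F52 F53 F56.
    have [[F66 _ F63] _] := L' 2 4 erefl F55.
    rewrite -F66 F44 in F63.
    by have [[<- _ _] _] := L 3 2 erefl F63.
  have [_ [F75 _ F65 _]] := L' 0 4 erefl F53.
  rewrite -F75 F44 in F65.
  by have [_ [-> <- _ _]] := L 3 4 erefl F65.
have L x y := @perfect_grid_slope F false x y PF.
have [_ [F53 _ _ _]] := L 1 3 erefl F44.
case F55: (F 5 5); rewrite F55 /= in F53.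
  by have [[F66 -> _] _] := L 2 4 erefl F55; rewrite -F66.
by have [_ [_ F64 -> _]] := L 2 2 erefl F53; rewrite -F64.
Qed.

(** What a tight function gives on the indices of P(n,k), extended to all of
    [nat]: [a p] says that u_p is nonempty (and v_p empty), [f p] that the chosen
    colour occurs at index p. *)
Definition perfect_code (n k : nat) (a f : nat -> bool) : Prop :=
  [/\ forall p, a p.+1 = ~~ a p, forall p, a (p + k) = ~~ a p,
      forall p, a (p + n) = a p /\ f (p + n) = f p,
      forall p, a p -> f p + f p.+1 + f p.+2 = 1 &
      forall p, ~~ a p -> f p + f (p + k) + f (p + k + k) = 1].

Lemma alternating_addn (a : nat -> bool) (d p m : nat) :
  (forall p, a (p + d) = ~~ a p) -> a (p + m * d) = a p (+) odd m.
Proof.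
move=> ad; elim: m => [|m IH]; first by rewrite mul0n addn0 addbF.
by rewrite mulSn addnCA addnC ad IH /= -addbN.
Qed.

Lemma perfect_code_step (n k : nat) (a f : nat -> bool) (p : nat) :
  0 < n -> perfect_code n k a f -> f p -> f (p + 3).
Proof.
move=> n0 [a1 ak afn fu fv] fp; have fn q : f (q + n) = f q := (afn q).2.
have fnm m q : f (q + m * n) = f q.
  by elim: m => [|m IH]; rewrite ?mul0n ?addn0 // mulSn addnCA addnC fn.
(* a multiple of the period makes room for the window to the left of p *)
have [b bE] : exists b, p + (4 + 4 * k) * n = b + 4 + 4 * k.
  exists (p + (4 + 4 * k) * n - (4 + 4 * k)); rewrite -addnA subnK //.
  by rewrite (leq_trans _ (leq_addl _ _)) // leq_pmulr.
pose F x y := f (b + x + y * k).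
have aE x y : a (b + x + y * k) = a b (+) odd (x + y).
  rewrite alternating_addn // -[x in b + x]muln1 alternating_addn ?oddD ?addbA //.
  by move=> q; rewrite addn1 a1.
have PF : perfect_grid F (~~ a b).
  split=> x y xy; rewrite /F.
    by rewrite !addnS !addSn fu // aE xy addbN addbb.
  have /fv : ~~ a (b + x + y * k) by rewrite aE xy negbK addbb.
  by rewrite !mulSn (addnC k) !(addnCA k) !addnA => <-; congr (_ + f _ + f _); lia.
rewrite -(fnm (4 + 4 * k)) (_ : p + 3 + _ = b + 7 + 4 * k); last by lia.
by apply: (perfect_grid_step PF); rewrite /F -bE fnm.
Qed.

(** The parities of c and k come from the alternation alone; divisibility by 3
    from the invariance of the class under p -> p + 3, since neither p, p + 1 nor
    p, p + k can both belong to it. *)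
Lemma perfect_code_arith (n k c : nat) (a f : nat -> bool) (p : nat) :
  0 < n -> n = c * k -> perfect_code n k a f -> f p ->
  c %% 6 = 0 /\ (k %% 6 = 1 \/ k %% 6 = 5).
Proof.
move=> n0 nE code fp; have [a1 ak afn fu fv] := code.
have an q : a (q + n) = a q := (afn q).1.
have fn q : f (q + n) = f q := (afn q).2.
have kodd : odd k.
  have : a (0 + k * 1) = a 0 (+) odd k.
    by apply: alternating_addn => q; rewrite addn1 a1.
  by rewrite muln1 ak; case: (odd k); case: (a 0).
have ceven : ~~ odd c.
  move: (an 0); rewrite nE alternating_addn //.
  by case: (odd c); case: (a 0).
have f3 q m : f q -> f (q + 3 * m).
  move=> fq; elim: m => [|m IH]; first by rewrite muln0 addn0.
  by rewrite mulnSr addnA (perfect_code_step n0 code).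
have no1 q : f q -> ~~ f q.+1.
  move=> fq; have [/fu|aq] := boolP (a q); first by rewrite fq; lia.
  have /fu : a (q + n.-1) by rewrite -[a _]negbK -a1 -addnS prednK // an.
  by rewrite -!addnS prednK // -addSnnS !fn fq; lia.
have nok q : f q -> ~~ f (q + k).
  move=> fq; have [aq|/fv] := boolP (a q); last by rewrite fq; lia.
  have kn : k <= n by rewrite nE leq_pmull; lia.
  have := fv (q + n - k); rewrite -(ak (q + n - k)) subnK; last by lia.
  by rewrite an (addnAC q n k) !fn => /(_ aq); lia.
have n3 : n %% 3 = 0.
  have := no1 p fp; have [//|[nE1|nE2]] : n %% 3 = 0 \/ n %% 3 = 1 \/ n %% 3 = 2 by lia.
    rewrite -fn -fn (_ : _ + n = p + 3 * ((2 * n + 1) %/ 3)); last by lia.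
    by rewrite f3.
  rewrite -fn (_ : _ + n = p + 3 * ((n + 1) %/ 3)); last by lia.
  by rewrite f3.
have k3 : k %% 3 <> 0.
  move=> k3; have := nok p fp; have := f3 p (k %/ 3) fp.
  by rewrite (_ : 3 * _ = k) => [->|]; lia.
have : 3 %| c * k by rewrite -nE; apply/dvdnP; exists (n %/ 3); lia.
by rewrite Euclid_dvdM //; lia.
Qed.

Lemma tight_perfect_code (n k t : nat)
    (g : {ffun 'I_n + 'I_n -> {set 'I_t}}) :
  0 < t < 6 -> 0 < k -> 2 * k < n -> rainbow_dom (petersen n k) g ->
  6 * weight g = t * #|{: 'I_n + 'I_n}| ->
  exists a f : nat -> bool, perfect_code n k a f.
Proof.
move=> t6 k0 kn gP tight; have n0 : 0 < n by lia.
have [bip one] := cubic_tight t6 (petersen_cubic k0 kn) gP tight.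
have [t0 _] := andP t6; pose x : 'I_t := Ordinal t0.
pose o p : 'I_n := Ordinal (ltn_pmod p n0).
have oD d p : shift d (o p) = o (p + d) by apply: val_inj; rewrite /= modnDml.
have on p : o (p + n) = o p by apply: val_inj; rewrite /= modnDr.
pose a p := g (inl (o p)) != set0.
pose f p := if a p then x \in g (inl (o p)) else x \in g (inr (o p)).
have spoke p : (g (inr (o p)) == set0) = a p.
  by apply: bip; rewrite petersen_nbr_outer ?inE ?eqxx ?orbT //; lia.
have a1 p : a p.+1 = ~~ a p.
  rewrite {1}/a (bip (inl (o p))) //.
  by rewrite petersen_nbr_outer ?oD ?addn1 ?inE ?eqxx //; lia.
have ak p : a (p + k) = ~~ a p.
  rewrite -!spoke; apply: bip.
  by rewrite petersen_nbr_inner ?oD ?inE ?eqxx //; lia.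
exists a, f; split => //.
- by move=> p; rewrite /f /a !on.
- move=> p ap.
  have /(one _ x) : g (inl (o p.+1)) = set0.
    by apply/eqP; move: (a1 p); rewrite ap /a; case: eqP.
  rewrite (petersen_big _ _ _ k0 kn) !oD addn1 (_ : p.+1 + _ = p + n); last by lia.
  by rewrite on /f !a1 ap /=; lia.
- move=> p ap.
  have /(one _ x) : g (inr (o (p + k))) = set0 by apply/eqP; rewrite spoke ak.
  rewrite (petersen_big _ _ _ k0 kn) !oD (_ : p + k + (_ - _) = p + n); last by lia.
  by rewrite on /f !ak (negPf ap) /=; lia.
Qed.

Lemma petersen_tight (c k t : nat)
    (g : {ffun 'I_(c * k) + 'I_(c * k) -> {set 'I_t}}) :
  0 < t < 6 -> 0 < k -> 3 <= c -> rainbow_dom (petersen (c * k) k) g ->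
  6 * weight g = t * #|{: 'I_(c * k) + 'I_(c * k)}| ->
  c %% 6 = 0 /\ (k %% 6 = 1 \/ k %% 6 = 5).
Proof.
move=> t6 k0 c3 gP tight; have kn : 2 * k < c * k by rewrite ltn_pmul2r.
have [a [f code]] := tight_perfect_code t6 k0 kn gP tight.
have n0 : 0 < c * k by rewrite muln_gt0 k0; lia.
have [p ap] : exists p, a p.
  case: code => a1 _ _ _ _; case: (boolP (a 0)) => a0; first by exists 0.
  by exists 1; rewrite a1.
have [q fq] : exists q, f q.
  case: code => _ _ _ /(_ p ap) + _; case fp: (f p); first by exists p.
  case fp1: (f p.+1); first by exists p.+1.
  by case fp2: (f p.+2); first by exists p.+2.
exact: perfect_code_arith n0 erefl code fq.
Qed.

(** * Reduction to three colours, and repair of partial assignments *)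

(** The block of colour 0 is made of 0 and of all colours from 3 on, those of 1
    and 2 are singletons; over the three shifts of the blocks each of the t
    colours is used |g(v)| times at v. *)
Lemma rainbow_dom_number_scale (V : finType) (e : rel V) (t : nat) :
  3 <= t -> 3 * rainbow_dom_number e t <= t * rainbow_dom_number e 3.
Proof.
move=> t3; have [g gP <-] := (rainbow_dom_number_min e 3).1.
pose phi (x : 'I_t) : 'I_3 := inord x.
pose h (r : 'I_3) : {ffun V -> {set 'I_t}} :=
  [ffun v => [set x | (phi x + r)%R \in g v]].
have surj r y : exists x, (phi x + r)%R = y.
  exists (widen_ord t3 (y - r)%R).
  by rewrite (_ : phi _ = y - r)%R ?subrK //; apply: inord_val.
have hP r : rainbow_dom e (h r).
  apply/forallP => v; apply/implyP => /eqP hv0.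
  have gv0 : g v == set0.
    apply/eqP/setP => y; rewrite inE; have [x <-] := surj r y.
    by move/setP/(_ x): hv0; rewrite ffunE !inE.
  move/forallP/(_ v)/implyP/(_ gv0)/eqP : gP => full.
  apply/eqP/setP => x; rewrite [RHS]inE; apply/bigcupP.
  have : (phi x + r)%R \in [set: 'I_3] by rewrite inE.
  by rewrite -full => /bigcupP[u evu xu]; exists u => //; rewrite ffunE inE.
have sumE : \sum_r weight (h r) = t * weight g.
  rewrite exchange_big big_distrr; apply: eq_bigr => v _ /=.
  transitivity (\sum_(r : 'I_3) \sum_(x : 'I_t) ((phi x + r)%R \in g v : nat)).
    apply: eq_bigr => r _; rewrite ffunE -sum1_card big_mkcond.
    by apply: eq_bigr => x _; rewrite inE; case: ifP.
  rewrite exchange_big /= -[t in RHS]card_ord -sum_nat_const.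
  apply: eq_bigr => x _; rewrite -sum1_card [RHS]big_mkcond.
  rewrite [RHS](reindex_inj (addrI (phi x))).
  by apply: eq_bigr => r _; case: ifP.
rewrite -sumE -[3 in leqLHS]card_ord -sum_nat_const.
by apply: leq_sum => r _; apply: (rainbow_dom_number_min e t).2.
Qed.

Definition repair_cost (V : finType) (e : rel V) (t : nat)
    (g : V -> {set 'I_t}) (v : V) : nat :=
  if g v == set0 then #|~: \bigcup_(u | e v u) g u| else #|g v|.

Lemma rainbow_dom_number_repair (V : finType) (e : rel V) (t : nat)
    (g : V -> {set 'I_t}) :
  rainbow_dom_number e t <= \sum_v repair_cost e g v.
Proof.
pose h : {ffun V -> {set 'I_t}} :=
  [ffun v => if g v == set0 then ~: \bigcup_(u | e v u) g u else g v].
have -> : \sum_v repair_cost e g v = weight h.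
  by apply: eq_bigr => v _; rewrite ffunE /repair_cost; case: ifP.
apply: (rainbow_dom_number_min e t).2.
have gh u : g u \subset h u.
  by rewrite ffunE; case: eqP => [->|_]; rewrite ?sub0set.
apply/forallP => v; apply/implyP; rewrite -subTset {1}ffunE.
case: ifP => [_ /eqP hv0|gv0]; last by rewrite gv0.
have <- : \bigcup_(u | e v u) g u = [set: 'I_t] by apply: setC_inj; rewrite hv0 setCT.
apply/bigcupsP => u evu.
exact: subset_trans (gh u) (bigcup_sup u evu).
Qed.

(** * The grid of columns and rows *)

Definition colours (P : nat -> bool) : {set 'I_3} := [set x : 'I_3 | P x].

Definition count3 (P : nat -> bool) : nat := P 0 + P 1 + P 2.

(** The repair cost of a vertex whose neighbours carry [a], [b] and [s], with
    sets of colours given by their characteristic functions, so that the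
    verifications below are arithmetic on residues. *)
Definition demand (own a b s : nat -> bool) : nat :=
  if count3 own == 0 then count3 (fun x => ~~ [|| a x, b x | s x])
  else count3 own.

Lemma card_colours (P : nat -> bool) : #|colours P| = count3 P.
Proof.
rewrite -sum1_card big_mkcond !big_ord_recr big_ord0 /= !inE /=.
by rewrite /count3; case: (P 0); case: (P 1); case: (P 2).
Qed.

Definition next_row (c j : nat) : nat := if j.+1 < c then j.+1 else 0.
Definition prev_row (c j : nat) : nat := if 0 < j then j.-1 else c.-1.

(** The rows form a helix: the last index of a row is followed by the first one of
    the next row. *)
Definition right_nbr (c k i j : nat) : nat * nat :=
  if i.+1 < k then (i.+1, j) else (0, next_row c j).
Definition left_nbr (c k i j : nat) : nat * nat :=
  if 0 < i then (i.-1, j) else (k.-1, prev_row c j).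

Definition site_cost (c k : nat) (U V : nat -> nat -> nat -> bool) (i j : nat)
    : nat :=
  demand (U i j) (U (right_nbr c k i j).1 (right_nbr c k i j).2)
    (U (left_nbr c k i j).1 (left_nbr c k i j).2) (V i j) +
  demand (V i j) (V i (next_row c j)) (V i (prev_row c j)) (U i j).

Lemma sum_ord_mul (c k : nat) (F : nat -> nat) :
  \sum_(p < c * k) F p = \sum_(j < c) \sum_(i < k) F (j * k + i).
Proof.
elim: c => [|c IH]; first by rewrite mul0n !big_ord0.
rewrite big_ord_recr /= -IH -!(big_mkord xpredT) (mulSn c) addnC.
rewrite (big_cat_nat (n := c * k)) ?leq_addr //=; congr (_ + _).
rewrite -{1}[c * k]add0n big_addn addKn big_mkord.
by apply: eq_bigr => i _; rewrite addnC.
Qed.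

Lemma grid_shift (c k i j : nat) (r := right_nbr c k i j) (l := left_nbr c k i j) :
  0 < k -> 1 < c -> i < k -> j < c ->
  [/\ r.1 < k /\ (j * k + i + 1) %% (c * k) = r.2 * k + r.1,
      l.1 < k /\ (j * k + i + (c * k - 1)) %% (c * k) = l.2 * k + l.1,
      (j * k + i + k) %% (c * k) = next_row c j * k + i &
      (j * k + i + (c * k - k)) %% (c * k) = prev_row c j * k + i].
Proof.
move=> k0 c1 ik jc.
have jk : j.+1 * k <= c * k by rewrite leq_mul2r jc orbT.
have c1k : 2 * k <= c * k by rewrite leq_mul2r c1 orbT.
rewrite mulSn in jk; rewrite /r /l /right_nbr /left_nbr.
have cP : c.-1 * k = c * k - k by rewrite -subn1 mulnBl mul1n.
have jlast : c <= j.+1 -> j * k = c * k - k by move=> cj; rewrite -cP; congr (_ * _); lia.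
have jS : j.+1 < c -> j * k + k + k <= c * k.
  by move=> cj; rewrite -2!(addnC k) -!mulSn leq_mul2r cj orbT.
have jP : 0 < j -> j * k = j.-1 * k + k by move=> j0; rewrite addnC -mulSn prednK.
have j0E : j = 0 -> j * k = 0 by move=> ->.
have nextE : next_row c j * k = if j.+1 < c then j * k + k else 0.
  by rewrite /next_row; case: ifP; rewrite // mulSn addnC.
have prevE : prev_row c j * k = if 0 < j then j * k - k else c * k - k.
  by rewrite /prev_row; case: ifP => // j0; rewrite (jP j0) addnK.
rewrite !modn_lt_double; try lia.
split.
- case: (ltnP i.+1 k) => ik' /=; split=> //; first by case: ltnP; lia.
  rewrite nextE; case: (ltnP j.+1 c) => jc'.
    by move: (jS jc'); case: ltnP; lia.
  by move: (jlast jc'); case: ltnP; lia.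
- case: (ltnP 0 i) => i0 /=; split; try lia; first by case: ltnP; lia.
  rewrite prevE; case: (ltnP 0 j) => j0.
    by move: (jP j0); case: ltnP; lia.
  have -> : j * k = 0 by apply: j0E; lia.
  by case: ltnP; lia.
- rewrite nextE; case: (ltnP j.+1 c) => jc'.
    by move: (jS jc'); case: ltnP; lia.
  by move: (jlast jc'); case: ltnP; lia.
rewrite prevE; case: (ltnP 0 j) => j0.
  by move: (jP j0); case: ltnP; lia.
have -> : j * k = 0 by apply: j0E; lia.
by case: ltnP; lia.
Qed.

Lemma rainbow_dom_number_grid (c k : nat) (U V : nat -> nat -> nat -> bool) :
  0 < k -> 3 <= c ->
  rainbow_dom_number (petersen (c * k) k) 3 <=
  \sum_(j < c) \sum_(i < k) site_cost c k U V i j.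
Proof.
move=> k0 c3; have kn : 2 * k < c * k by rewrite ltn_pmul2r.
pose at_ (W : nat -> nat -> nat -> bool) p := W (p %% k) (p %/ k).
pose g (x : 'I_(c * k) + 'I_(c * k)) : {set 'I_3} :=
  match x with inl p => colours (at_ U p) | inr p => colours (at_ V p) end.
apply: leq_trans (rainbow_dom_number_repair _ g) _.
rewrite big_sumType /= -big_split /=.
have atE W i j : i < k -> at_ W (j * k + i) = W i j.
  by move=> ik; rewrite /at_ modnMDl modn_small // divnMDl // divn_small ?addn0.
have demandE (T : finType) (P : pred T) own a b s (G : T -> {set 'I_3}) v :
    G v = colours own ->
    \bigcup_(u | P u) G u = colours a :|: colours b :|: colours s ->
    (if G v == set0 then #|~: \bigcup_(u | P u) G u| else #|G v|) = demand own a b s.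
  move=> -> ->; rewrite /demand -cards_eq0 card_colours; case: ifP => // _.
  by rewrite -card_colours; apply: eq_card => x; rewrite !inE orbA.
have -> : \sum_(j < c) \sum_(i < k) site_cost c k U V i j =
    \sum_(p < c * k) site_cost c k U V (p %% k) (p %/ k).
  rewrite (sum_ord_mul c k (fun p => site_cost c k U V (p %% k) (p %/ k))).
  apply: eq_bigr => j _; apply: eq_bigr => i _.
  by rewrite modnMDl modn_small // divnMDl // divn_small ?addn0.
apply: leq_sum => p _; rewrite /site_cost.
set i := p %% k; set j := p %/ k.
have ik : i < k by rewrite ltn_mod.
have jc : j < c by rewrite ltn_divLR.
have pE : p = j * k + i :> nat by rewrite /j /i -divn_eq.
have [[rk rE] [lk lE] uE dE] := grid_shift k0 (ltnW c3) ik jc.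
have gin d i' j' : i' < k -> (p + d) %% (c * k) = j' * k + i' ->
    (g (inl (shift d p)) = colours (U i' j')) *
    (g (inr (shift d p)) = colours (V i' j')).
  by move=> ik' E; rewrite /g /= E !atE.
rewrite -pE in rE lE uE dE.
apply: eq_leq; congr (_ + _); apply: demandE.
- by [].
- by rewrite petersen_big // (gin _ _ _ rk rE) (gin _ _ _ lk lE).
- by [].
by rewrite petersen_big // (gin _ _ _ ik uE) (gin _ _ _ ik dE).
Qed.

(** * Stripes continuing across the columns *)

Lemma demand_nonempty (own a b s : nat -> bool) :
  0 < count3 own -> demand own a b s = count3 own.
Proof. by rewrite /demand; case: eqP => // ->. Qed.

Lemma demand_covered (own a b s : nat -> bool) :
  (forall x, x < 3 -> [|| a x, b x | s x]) -> demand own a b s = count3 own.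
Proof. by move=> cov; rewrite /demand {2}/count3 !cov //; case: eqP. Qed.

Lemma demand_missing_one (y : nat) (own a b s : nat -> bool) :
  count3 own <= 1 -> (forall x, x < 3 -> x != y -> [|| a x, b x | s x]) ->
  demand own a b s <= 1.
Proof.
move=> own1 cov; rewrite /demand; case: eqP => // _; rewrite /count3.
have := cov 0; have := cov 1; have := cov 2.
by case: y {cov} => [|[|y]] /= => [c2 c1 _|c2 _ c0|_ c1 c0];
  rewrite ?c0 ?c1 ?c2 //; case: [|| _, _ | _].
Qed.

Lemma count3_eq_mod3 (b : bool) (r : nat) :
  count3 (fun x => b && (x == r %% 3)) = b.
Proof.
have : r %% 3 < 3 by rewrite ltn_mod.
by rewrite /count3; case: b; case: (r %% 3) => [|[|[|]]].
Qed.

(** The stripes of slope [e], on the half of the vertices selected by [b]: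
    [false] for outer and [true] for inner vertices. *)
Definition stripes (b : bool) (e i j x : nat) : bool :=
  (odd (i + j) == b) && (x == (i + e * j) %% 3).

Lemma count3_stripes (b : bool) (e i j : nat) :
  count3 (stripes b e i j) = (odd (i + j) == b).
Proof. exact: count3_eq_mod3. Qed.

Lemma stripes_covers (b : bool) (e i j x : nat) :
  odd (i + j) = b -> x = (i + e * j) %% 3 -> stripes b e i j x.
Proof. by move=> oij ->; rewrite /stripes oij !eqxx. Qed.

Lemma mod3_steps (r d x : nat) :
  d %% 3 != 0 -> x < 3 ->
  [\/ x = r %% 3, x = (r + d) %% 3 | x = (r + d + d) %% 3].
Proof.
move=> d0 x3; have : [|| x == r %% 3, x == (r + d) %% 3 | x == (r + d + d) %% 3] by lia.
by case/or3P => /eqP; [apply: Or31|apply: Or32|apply: Or33].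
Qed.

Lemma mul_pred_mod3 (e c : nat) :
  0 < c -> c %% 6 = 0 -> (e * c.-1 + e) %% 3 = 0.
Proof.
move=> c0 c6; rewrite addnC -mulnS prednK // -modnMmr.
by rewrite (_ : c %% 3 = 0) ?muln0 //; lia.
Qed.

(** With slope k modulo 3 the colour is the index modulo 3 and the parity is that
    of the index, so the pattern only breaks between the indices ck - 1 and 0:
    at the inner vertices of the first and last rows and at the outer vertex of
    the last corner. It does not break at all when 6 divides c. *)
Lemma stripes_cost (c k i j : nat) :
  0 < k -> 3 <= c -> i < k -> j < c -> odd k -> k %% 3 != 0 ->
  site_cost c k (stripes false (k %% 3)) (stripes true (k %% 3)) i j <=
  1 + (c %% 6 != 0) *
    ((j == 0) * (~~ odd i) + (j == c.-1) * (~~ odd (i + c.-1)) +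
     ((i == k.-1) && (j == c.-1)) * odd (k + c)).
Proof.
move=> k0 c3 ik jc kodd k3; rewrite /site_cost.
have [e ek] : exists e, k %% 3 = e by exists (k %% 3).
rewrite ek in k3 *; have e3 : e %% 3 != 0 by rewrite -ek modn_mod ek.
have [oij|eij] := boolP (odd (i + j)).
  rewrite addnC demand_nonempty ?count3_stripes ?oij //= leq_add2l.
  have own0 : count3 (stripes false e i j) = 0 by rewrite count3_stripes oij.
  have spoke x : x = (i + e * j) %% 3 -> stripes true e i j x.
    exact: stripes_covers.
  have left x : x = (i + e * j + 1 + 1) %% 3 ->
      stripes false e (left_nbr c k i j).1 (left_nbr c k i j).2 x.
    rewrite /left_nbr; case: (posnP i) => i0 ->; apply: stripes_covers => /=.
    - by rewrite /prev_row; case: j oij {jc own0 spoke} => [|j] /=; lia.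
    - rewrite /prev_row; case: j oij {jc own0 spoke} => [|j] /=; first by lia.
      by rewrite mulnS; move: (e * j) => w; lia.
    - by lia.
    - by move: (e * j) => w; lia.
  have right x : (c %% 6 == 0) || ((i != k.-1) || (j != c.-1)) ->
      x = (i + e * j + 1) %% 3 ->
      stripes false e (right_nbr c k i j).1 (right_nbr c k i j).2 x.
    rewrite /right_nbr => nc ->.
    case: (ltnP i.+1 k) => ik'; first by apply: stripes_covers => /=; lia.
    have iE : i = k.-1 by lia.
    rewrite /next_row; case: (ltnP j.+1 c) => jc'; apply: stripes_covers => /=.
    - by lia.
    - by rewrite mulnS; move: (e * j) => w; lia.
    - by [].
    have jE : j = c.-1 by lia.
    have c6 : c %% 6 = 0 by move: nc; rewrite iE jE !eqxx !orbF => /eqP.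
    by rewrite muln0 jE; have := mul_pred_mod3 e (ltnW (ltnW c3)) c6; move: (e * c.-1) => w; lia.
  have [nc|] := boolP ((c %% 6 == 0) || ((i != k.-1) || (j != c.-1))).
    rewrite demand_covered ?own0 // => x x3.
    case: (@mod3_steps (i + e * j) 1 x isT x3) => E.
    - by rewrite (spoke x E) !orbT.
    - by rewrite (right x nc E).
    by rewrite (left x E) orbT.
  rewrite !negb_or !negbK => /and3P[c6 /eqP iE /eqP jE].
  have -> : odd (k + c) by move: oij; rewrite iE jE; lia.
  apply: (@leq_trans 1); last by rewrite c6 iE jE !eqxx; lia.
  apply: (demand_missing_one (y := (i + e * j + 1) %% 3)); rewrite ?own0 // => x x3 xy.
  case: (@mod3_steps (i + e * j) 1 x isT x3) => E.
  - by rewrite (spoke x E) !orbT.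
  - by rewrite E eqxx in xy.
  by rewrite (left x E) orbT.
rewrite demand_nonempty ?count3_stripes ?(negPf eij) //= leq_add2l.
have own0 : count3 (stripes true e i j) = 0 by rewrite count3_stripes (negPf eij).
have spoke x : x = (i + e * j) %% 3 -> stripes false e i j x.
  by apply: stripes_covers; apply: negPf.
have up x : (c %% 6 == 0) || (j != c.-1) -> x = (i + e * j + e) %% 3 ->
    stripes true e i (next_row c j) x.
  move=> nc ->; rewrite /next_row; case: (ltnP j.+1 c) => jc'; apply: stripes_covers.
  - by rewrite addnS /= eij.
  - by rewrite mulnS; move: (e * j) => w; lia.
  - by move: eij; lia.
  have jE : j = c.-1 by lia.
  have c6 : c %% 6 = 0 by move: nc; rewrite jE eqxx orbF => /eqP.
  by rewrite muln0 jE; have := mul_pred_mod3 e (ltnW (ltnW c3)) c6; move: (e * c.-1) => w; lia.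
have down x : (c %% 6 == 0) || (j != 0) -> x = (i + e * j + e + e) %% 3 ->
    stripes true e i (prev_row c j) x.
  move=> nc ->; rewrite /prev_row; case: (posnP j) => j0; apply: stripes_covers.
  - by move: eij; lia.
  - have c6 : c %% 6 = 0 by move: nc; rewrite j0 orbF => /eqP.
    by rewrite j0 muln0; have := mul_pred_mod3 e (ltnW (ltnW c3)) c6; move: (e * c.-1) => w; lia.
  - by move: eij; lia.
  by rewrite -[j in LHS](prednK j0) mulnS; move: (e * j.-1) => w; lia.
have [inner|bdry] := boolP ((c %% 6 == 0) || ((j != 0) && (j != c.-1))).
  rewrite demand_covered ?own0 // => x x3.
  have [nu nd] : (c %% 6 == 0) || (j != c.-1) /\ (c %% 6 == 0) || (j != 0).
    by case/orP: inner => [->|/andP[-> ->]]; rewrite ?orbT.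
  case: (@mod3_steps (i + e * j) e x e3 x3) => E.
  - by rewrite (spoke x E) !orbT.
  - by rewrite (up x nu E).
  by rewrite (down x nd E) orbT.
have {bdry} [c6 jE] : c %% 6 != 0 /\ (j = c.-1 \/ j = 0).
  by move: bdry; rewrite negb_or negb_and !negbK orbC => /andP[? /orP[]/eqP]; auto.
rewrite c6 mul1n; case: jE => jE.
  apply: (@leq_trans 1); last first.
    by rewrite jE eqxx -jE eij addnAC leq_addl.
  apply: (demand_missing_one (y := (i + e * j + e) %% 3)); rewrite ?own0 // => x x3 xy.
  have nd : (c %% 6 == 0) || (j != 0) by lia.
  case: (@mod3_steps (i + e * j) e x e3 x3) => E.
  - by rewrite (spoke x E) !orbT.
  - by rewrite E eqxx in xy.
  by rewrite (down x nd E) orbT.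
apply: (@leq_trans 1).
  apply: (demand_missing_one (y := (i + e * j + e + e) %% 3)); rewrite ?own0 // => x x3 xy.
  have nu : (c %% 6 == 0) || (j != c.-1) by lia.
  case: (@mod3_steps (i + e * j) e x e3 x3) => E.
  - by rewrite (spoke x E) !orbT.
  - by rewrite (up x nu E).
  by rewrite E eqxx in xy.
by move: eij; rewrite jE eqxx addn0 => ->; rewrite -addnA leq_addr.
Qed.

Lemma sum_pick (n p : nat) (F : nat -> nat) :
  p < n -> \sum_(i < n) (i == p :> nat) * F i = F p.
Proof.
move=> pn; rewrite (bigD1 (Ordinal pn)) //= eqxx mul1n big1 ?addn0 // => i ip.
rewrite (_ : (i == p :> nat) = false) //; apply: contraNF ip => /eqP ip.
exact/eqP/val_inj.
Qed.

(** In all the constructions a column and row (i, j) costs 1 up to an excess that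
    is located on the four sides of the rectangle. *)
Lemma rainbow_dom_number_margins (c k : nat) (U V : nat -> nat -> nat -> bool)
    (bot top left right : nat -> nat) :
  0 < k -> 3 <= c ->
  (forall i j, i < k -> j < c -> site_cost c k U V i j <=
     1 + ((j == 0) * bot i + (j == c.-1) * top i +
          (i == 0) * left j + (i == k.-1) * right j)) ->
  rainbow_dom_number (petersen (c * k) k) 3 <=
  c * k + (\sum_(i < k) bot i + \sum_(i < k) top i +
           \sum_(j < c) left j + \sum_(j < c) right j).
Proof.
move=> k0 c3 bound; apply: leq_trans (rainbow_dom_number_grid U V k0 c3) _.
pose m (i j : nat) := (j == 0) * bot i + (j == c.-1) * top i +
          (i == 0) * left j + (i == k.-1) * right j.
apply: (@leq_trans (\sum_(j < c) \sum_(i < k) (1 + m i j))).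
  by apply: leq_sum => j _; apply: leq_sum => i _; apply: bound.
have c0 : 0 < c by lia.
have -> : \sum_(j < c) \sum_(i < k) (1 + m i j) =
    \sum_(j < c) \sum_(i < k) 1 + \sum_(j < c) \sum_(i < k) m i j.
  by rewrite -big_split; apply: eq_bigr => j _; rewrite -big_split.
rewrite sum_nat_const sum1_card !card_ord leq_add2l eq_leq //.
rewrite /m; under eq_bigr do rewrite !big_split /=.
rewrite !big_split /=; congr (_ + _ + _ + _).
- by rewrite exchange_big; apply: eq_bigr => i _; rewrite (sum_pick (fun=> _)).
- by rewrite exchange_big; apply: eq_bigr => i _; rewrite (sum_pick (fun=> _)) ?prednK.
- by apply: eq_bigr => j _; rewrite (sum_pick (fun=> _)).
- by apply: eq_bigr => j _; rewrite (sum_pick (fun=> _)) ?prednK.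
Qed.

Lemma sum_even_odd (n : nat) :
  (\sum_(i < n) (odd i : nat) = n./2) * (\sum_(i < n) (~~ odd i : nat) = uphalf n).
Proof.
elim: n => [|n [IH1 IH2]]; first by rewrite !big_ord0.
by rewrite !big_ord_recr /= IH1 IH2; split; lia.
Qed.

Lemma stripes_bound (c k : nat) :
  0 < k -> 3 <= c -> k %% 6 = 1 \/ k %% 6 = 5 ->
  rainbow_dom_number (petersen (c * k) k) 3 <=
  c * k + (c %% 6 != 0) * k.+1.
Proof.
move=> k0 c3 k6; have [kodd k3] : odd k /\ k %% 3 != 0 by lia.
pose q : nat := c %% 6 != 0.
have := @rainbow_dom_number_margins c k (stripes false (k %% 3)) (stripes true (k %% 3))
  (fun i => q * ~~ odd i) (fun i => q * ~~ odd (i + c.-1)) (fun=> 0)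
  (fun j => q * ((j == c.-1) * odd (k + c))) k0 c3.
move/(_ _)/leq_trans; apply.
  move=> i j ik jc; apply: leq_trans (stripes_cost k0 c3 ik jc kodd k3) _.
  by rewrite -/q; case: (i == k.-1); case: (j == c.-1); case: (j == 0); lia.
rewrite leq_add2l -/q -!big_distrr /= sum_even_odd.
rewrite big1_eq (sum_pick (fun=> odd (k + c) : nat)); last by lia.
have -> : \sum_(i < k) ~~ odd (i + c.-1) = if odd c then uphalf k else k./2.
  rewrite -!sum_even_odd; case: ifP => oc; apply: eq_bigr => i _; congr nat_of_bool; lia.
by rewrite addn0 -!mulnDr leq_mul2l; case: ifP; lia.
Qed.

(** * Filling empty pairs along the cuts *)

(** Stripes of slope 1, in which an empty vertex of the last column receives the
    colour that its neighbour in column 0 lacks. That neighbour lies in row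
    j + 1 and lacks the colour j of the column -1 there; after the last row it
    lies in row 0 and lacks -1, that is 2. *)
Definition filled_outer (c k i j x : nat) : bool :=
  if odd (i + j) then (i == k.-1) && (x == (if j == c.-1 then 2 else j) %% 3)
  else x == (i + j) %% 3.

(** Likewise across the cut between the last row and row 0: the vertex in row 0
    lacks i - 1. *)
Definition filled_inner (c i j x : nat) : bool :=
  if odd (i + j) then x == (i + j) %% 3
  else (j == c.-1) && (x == (i + 2) %% 3).

Lemma count3_filled_outer (c k i j : nat) :
  count3 (filled_outer c k i j) = (odd (i + j) ==> (i == k.-1)).
Proof.
rewrite /filled_outer; case: (odd (i + j)); first exact: count3_eq_mod3.
exact: (count3_eq_mod3 true).
Qed.

Lemma count3_filled_inner (c i j : nat) :
  count3 (filled_inner c i j) = (odd (i + j) || (j == c.-1)).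
Proof.
rewrite /filled_inner; case: (odd (i + j)); last exact: count3_eq_mod3.
exact: (count3_eq_mod3 true).
Qed.

(** A filled vertex pays for itself and, when the edge across the cut joins two
    empty vertices, for the other end too. This happens between the last and
    first columns when k is even, and between the last and first rows when c is
    odd; otherwise the first column, or row, has to be repaired separately. *)
Lemma filled_cost (c k i j : nat) :
  1 < k -> 3 <= c -> i < k -> j < c -> ~~ odd k || odd c ->
  site_cost c k (filled_outer c k) (filled_inner c) i j <=
  1 + ((j == 0) * (~~ odd i && ~~ odd c) + (j == c.-1) * ~~ odd (i + c.-1) +
       (i == 0) * (odd j && odd k) + (i == k.-1) * odd (k.-1 + j)).
Proof.
move=> k1 c3 ik jc kc; rewrite /site_cost.
have [oij|eij] := boolP (odd (i + j)).
  rewrite addnC demand_nonempty ?count3_filled_inner ?oij //= leq_add2l.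
  have [ik'|ik'] := eqVneq i k.-1.
    rewrite demand_nonempty ?count3_filled_outer oij -ik' eqxx //=.
    by rewrite oij mul1n leq_addl.
  have iSk : i.+1 < k by lia.
  have oSij : odd (i.+1 + j) = false by rewrite addSn /= oij.
  case: i => [|i] in ik oij ik' iSk oSij *; last first.
    rewrite demand_covered ?count3_filled_outer ?oij /= ?(negPf ik') // => x x3.
    rewrite /filled_outer /filled_inner /right_nbr /left_nbr iSk /=.
    by move: oij; rewrite addSn /= => /negPf-> /=; lia.
  have [ok|ek] := boolP (odd k).
    apply: (@leq_trans 1).
      apply: (demand_missing_one (y := (j + 2) %% 3));
        rewrite ?count3_filled_outer ?oij /= ?(negPf ik') // => x x3 xy.
      rewrite /filled_outer /filled_inner /right_nbr iSk oij oSij; rewrite /= orbCA.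
      by apply/orP; right; move: xy; lia.
    by move: oij; rewrite add0n => ->; rewrite addnAC leq_addl.
  case: j => [//|j] in jc oij oSij *.
  rewrite demand_covered ?count3_filled_outer ?oij /= ?(negPf ik') // => x x3.
  rewrite /filled_outer /filled_inner /right_nbr /left_nbr iSk oij oSij /=.
  have -> : odd (k.-1 + j) by move: oij; lia.
  have -> : (j == c.-1) = false by lia.
  by rewrite eqxx /prev_row /=; lia.
rewrite demand_nonempty ?count3_filled_outer ?(negPf eij) //= leq_add2l.
have [jc'|jc'] := eqVneq j c.-1.
  rewrite demand_nonempty ?count3_filled_inner (negPf eij) -jc' eqxx //=.
  by rewrite eij mul1n -addnA addnAC leq_addl.
have jSc : j.+1 < c by lia.
have oijS : odd (i + j.+1) by rewrite addnS /= eij.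
case: j => [|j] in jc eij jc' jSc oijS *; last first.
  rewrite demand_covered ?count3_filled_inner ?(negPf eij) /= ?(negPf jc') // => x x3.
  rewrite /filled_outer /filled_inner /next_row /prev_row jSc /= !addnS /=.
  by move: eij; rewrite addnS /= negbK => -> /=; lia.
have [oc|ec] := boolP (odd c); last first.
  apply: (@leq_trans 1).
    apply: (demand_missing_one (y := (i + 2) %% 3));
      rewrite ?count3_filled_inner ?(negPf eij) /= ?(negPf jc') // => x x3 xy.
    rewrite /filled_outer /filled_inner /next_row jSc (negPf eij) oijS /= orbCA.
    by apply/orP; right; move: xy; lia.
  by move: eij; rewrite addn0 => ->; rewrite -!addnA leq_addr.
rewrite demand_covered ?count3_filled_inner ?(negPf eij) /= ?(negPf jc') // => x x3.
rewrite /filled_outer /filled_inner /next_row jSc /= (negPf eij) oijS.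
have -> : odd (i + c.-1) = false by move: eij; lia.
by rewrite eqxx /=; lia.
Qed.

Lemma sum_odd_addn (n m : nat) :
  \sum_(i < n) (odd (m + i) : nat) = if odd m then uphalf n else n./2.
Proof.
by rewrite -!sum_even_odd; case: ifP => om; apply: eq_bigr => i _;
  rewrite oddD om.
Qed.

Lemma filled_bound (c k : nat) :
  1 < k -> 3 <= c -> ~~ odd k || odd c ->
  rainbow_dom_number (petersen (c * k) k) 3 + 2 <= c * k + c + k.
Proof.
move=> k1 c3 kc; have k0 : 0 < k by lia.
apply: (@leq_trans (c * k + (~~ odd c * uphalf k +
    (if odd c then uphalf k else k./2) + odd k * c./2 +
    (if odd k then c./2 else uphalf c)) + 2)); last first.
  have [oc|ec] := boolP (odd c); have [ok|ek] := boolP (odd k) => /=;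
    rewrite ?mul0n ?mul1n; lia.
rewrite leq_add2r.
have := @rainbow_dom_number_margins c k (filled_outer c k) (filled_inner c)
  (fun i => ~~ odd i && ~~ odd c) (fun i => ~~ odd (i + c.-1))
  (fun j => odd j && odd k) (fun j => odd (k.-1 + j)) k0 c3.
move/(_ (fun i j ik jc => filled_cost k1 c3 ik jc kc))/leq_trans; apply.
rewrite leq_add2l eq_leq //; congr (_ + _ + _ + _).
- by rewrite -sum_even_odd big_distrr; apply: eq_bigr => i _ /=; rewrite andbC mulnb.
- transitivity (\sum_(i < k) (odd (c + i) : nat)); last exact: sum_odd_addn.
  by apply: eq_bigr => i _; congr nat_of_bool; lia.
- by rewrite -sum_even_odd big_distrr; apply: eq_bigr => i _ /=; rewrite andbC mulnb.
rewrite sum_odd_addn; case: ifP; case: ifP => //; lia.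
Qed.

(** * Doubling colours in the first row *)

(** The second colour i + c in row 0 is the one that the inner vertices of the
    last row expect above them. It pays off in all of row 0 when c is 2
    modulo 3, where it also completes the neighbourhoods inside row 0, and at
    (k-1, 0) when c is 1 modulo 3, where it also serves the outer vertex of that
    corner; when c is 0 modulo 3 it coincides with the first one. *)
Definition patched_colours (c k i j x : nat) : bool :=
  (x == (i + j) %% 3) ||
  [&& j == 0, (c %% 3 == 2) || (i == k.-1) & x == (i + c) %% 3].

(** Used with [true] for the outer vertices: they are nonempty where i + j is odd,
    so that the outer vertex of the corner (k-1, 0) is an empty one. *)
Definition patched (b : bool) (c k i j x : nat) : bool :=
  (odd (i + j) == b) && patched_colours c k i j x.

Lemma count3_patched (b : bool) (c k i j : nat) :
  count3 (patched b c k i j) =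
  if odd (i + j) == b then
    ([&& j == 0, (c %% 3 == 2) || (i == k.-1) & c %% 3 != 0]).+1 else 0.
Proof.
rewrite /patched; case: eqP => _ //=; rewrite /patched_colours /count3.
have r3 : (i + j) %% 3 < 3 by rewrite ltn_mod.
have [->|_] := eqVneq j 0; last first.
  by rewrite !orbF; case: (_ %% 3) r3 => [|[|[|]]].
rewrite addn0; case: ((c %% 3 == 2) || _) => /=; last first.
  by rewrite !orbF; case: (i %% 3) (ltn_pmod i (isT : 0 < 3)) => [|[|[|]]].
rewrite -[(i + c) %% 3]modnDm; have := ltn_pmod c (isT : 0 < 3).
case: (i %% 3) (ltn_pmod i (isT : 0 < 3)) => [|[|[|]]] // _;
by case: (c %% 3) => [|[|[|]]].
Qed.

Lemma patched_covers (b : bool) (c k i j x : nat) :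
  odd (i + j) = b -> x = (i + j) %% 3 -> patched b c k i j x.
Proof. by move=> oij ->; rewrite /patched oij /patched_colours !eqxx. Qed.

Lemma patched_covers0 (b : bool) (c k i x : nat) :
  odd i = b -> (c %% 3 == 2) || (i == k.-1) -> x = (i + c) %% 3 ->
  patched b c k i 0 x.
Proof. by move=> oi ci ->; rewrite /patched addn0 oi /patched_colours ci !eqxx orbT. Qed.

Definition patch_margin (c k i : nat) : nat :=
  if c %% 3 == 0 then (i == 0) + (i == k.-1)
  else if c %% 3 == 1 then nat_of_bool (odd i || (i == k.-1)) else 1.

(** When c is 0 modulo 3 the pattern is periodic vertically. When c is 2 modulo 3,
    row 0 costs one more per column, and all the vertices of row 0 as well as the
    inner ones of the last row are dominated. When c is 1 modulo 3, the patch at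
    the inner vertex of the corner (k-1, 0) serves the outer vertex of this
    corner and the inner vertex of the corner (k-1, c-1), and the outer vertex at
    (0, 0) sees the colour it expects at (k-1, c-1). *)
Lemma patched_cost (c k i j : nat) :
  k %% 6 = 3 -> 3 <= c -> ~~ odd c -> i < k -> j < c ->
  site_cost c k (patched true c k) (patched false c k) i j <=
  1 + ((j == 0) * patch_margin c k i +
       (j == c.-1) * [&& c %% 3 == 1, ~~ odd i & i != k.-1] +
       (i == 0) * (~~ odd j && (j != 0)) + (i == k.-1) * (~~ odd j && (j != 0))).
Proof.
move=> k6 c3 oc ik jc; rewrite /site_cost.
have cov3 (a b s : nat -> bool) y :
    (forall x, x = y.+1 %% 3 \/ x = y.+2 %% 3 -> a x || b x || s x) ->
    forall x, x < 3 -> x != y %% 3 -> [|| a x, b x | s x].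
  by move=> abs x x3 xy; rewrite orbA; apply: abs; lia.
have [oij|eij] := boolP (odd (i + j)).
  rewrite demand_nonempty ?count3_patched ?oij //=.
  have own0 : count3 (patched false c k i j) = 0 by rewrite count3_patched oij.
  have oSij : odd (i + j.+1) = false by rewrite addnS /= oij.
  have [j0|j0] := posnP j.
    subst j; rewrite addn0 in oij; rewrite /patch_margin oij.
    have -> : (i == k.-1) = false by lia.
    have i0 : (i == 0) = false by case: i oij {ik own0 oSij}.
    have jSc : 1 < c by lia.
    have iSc : odd (i + c.-1) = false by lia.
    have [c1|c1] := eqVneq (c %% 3) 1.
      have : demand (patched false c k i 0) (patched false c k i (next_row c 0))
          (patched false c k i (prev_row c 0)) (patched true c k i 0) <= 1.
        apply: (demand_missing_one (y := (i + 2) %% 3)); first by rewrite own0.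
        apply: cov3 => x; rewrite /next_row /prev_row jSc /= => -[xE|xE].
          by rewrite (@patched_covers true) ?addn0 ?orbT //; lia.
        by rewrite (@patched_covers false c k i 1) //; lia.
      by rewrite c1 /=; lia.
    rewrite demand_covered ?own0 => [|x x3].
      by rewrite i0; case: (c %% 3 == 0); lia.
    rewrite /next_row /prev_row jSc /=.
    have [->|[->|->]] : x = (i + 0) %% 3 \/ x = (i + 1) %% 3 \/ x = (i + 2) %% 3 by lia.
    - by rewrite (@patched_covers true) ?addn0 ?orbT.
    - by rewrite (@patched_covers false).
    have [c2|c2] := eqVneq (c %% 3) 2.
      by rewrite (@patched_covers0 true) ?c2 ?orbT //; lia.
    by rewrite (@patched_covers false c k i c.-1) ?orbT //; lia.
  have [jc'|jc'] /= := ltnP j.+1 c.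
    rewrite demand_covered ?own0 // => x x3.
    rewrite /next_row /prev_row jc' j0.
    have [E|[E|E]] : x = (i + j) %% 3 \/ x = (i + j.+1) %% 3 \/ x = (i + j.-1) %% 3 by lia.
    - by rewrite (@patched_covers true) ?orbT.
    - by rewrite (@patched_covers false c k i j.+1).
    by rewrite (@patched_covers false c k i j.-1) ?orbT //; lia.
  have jE : j = c.-1 by lia.
  have ei : odd i = false by lia.
  have [/andP[/eqP c1 ik']|ck] := boolP ((c %% 3 == 1) && (i != k.-1)).
    apply: (@leq_trans 2); last by rewrite jE eqxx c1 ei ik'; lia.
    apply: (demand_missing_one (y := (i + j.+1) %% 3)); first by rewrite own0.
    apply: cov3 => x; rewrite /next_row /prev_row ltnNge jc' j0 /= => -[xE|xE].
      by rewrite (@patched_covers false c k i j.-1) ?orbT //; lia.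
    by rewrite (@patched_covers true) ?orbT //; lia.
  rewrite demand_covered ?own0 // => x x3.
  rewrite /next_row /prev_row ltnNge jc' j0 /=.
  have [E|[E|E]] : x = (i + j) %% 3 \/ x = (i + c) %% 3 \/ x = (i + j.-1) %% 3 by lia.
  - by rewrite (@patched_covers true) ?orbT.
  - have [c0|c0] := eqVneq (c %% 3) 0.
      by rewrite (@patched_covers false c k i 0) ?addn0 //; lia.
    by rewrite (@patched_covers0 false) //; lia.
  by rewrite (@patched_covers false c k i j.-1) ?orbT //; lia.
rewrite addnC demand_nonempty ?count3_patched ?(negPf eij) //=.
have own0 : count3 (patched true c k i j) = 0 by rewrite count3_patched (negPf eij).
have oiSj : odd (i.+1 + j) by rewrite addSn /= (negPf eij).
have [i0|i0] := posnP i.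
  subst i; rewrite add0n in eij; have iSk : 1 < k by lia.
  have k10 : (0 == k.-1) = false by lia.
  rewrite k10 eij /patch_margin /= orbF addn0.
  have [j0|j0] := posnP j.
    subst j; rewrite /right_nbr /left_nbr iSk /= /prev_row /=.
    have [c0|c0] := eqVneq (c %% 3) 0.
      apply: (@leq_trans 2); last by rewrite c0.
      rewrite c0 /= add1n ltnS.
      apply: (demand_missing_one (y := 2 %% 3)); first by rewrite own0.
      apply: cov3 => x /= -[xE|xE].
        by rewrite (@patched_covers false) ?addn0 ?orbT //; lia.
      by rewrite (@patched_covers true c k 1 0) //; lia.
    rewrite demand_covered ?own0 => [|x x3].
      by case: (c %% 3) c0 (ltn_pmod c (isT : 0 < 3)) => [|[|[|]]] //= _ _; lia.
    have [->|[->|->]] : x = 0 \/ x = 1 \/ x = 2 by lia.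
    - by rewrite (@patched_covers false) ?addn0 ?orbT.
    - by rewrite (@patched_covers true c k 1 0).
    have [c2|c2] := eqVneq (c %% 3) 2.
      by rewrite (@patched_covers0 false) ?c2 ?orbT.
    by rewrite (@patched_covers true c k k.-1 c.-1) ?orbT //; lia.
  rewrite /=; apply: (@leq_trans 2); last by lia.
  rewrite add1n ltnS; apply: (demand_missing_one (y := (j + 2) %% 3)); first by rewrite own0.
  apply: cov3 => x; rewrite /right_nbr iSk => -[xE|xE].
    by rewrite (@patched_covers false) ?orbT //; lia.
  by rewrite (@patched_covers true c k 1 j) //; lia.
have oiPj : odd (i.-1 + j) by move: eij; lia.
have [ik'|ik'] := eqVneq i k.-1; last first.
  have iSk : i.+1 < k by lia.
  rewrite demand_covered ?own0 => [|x x3].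
    rewrite /patch_margin (negPf ik') orbF; case: (j == 0) => //=.
    by case: (c %% 3) (ltn_pmod c (isT : 0 < 3)) => [|[|[|]]].
  rewrite /right_nbr /left_nbr iSk i0 /=.
  have [E|[E|E]] : x = (i + j) %% 3 \/ x = (i.+1 + j) %% 3 \/ x = (i.-1 + j) %% 3 by lia.
  - by rewrite (@patched_covers false) ?orbT //; lia.
  - by rewrite (@patched_covers true c k i.+1).
  by rewrite (@patched_covers true c k i.-1) ?orbT.
have iSk : (i.+1 < k) = false by lia.
have ei : odd i = false by lia.
have ej : odd j = false by lia.
have [j0|j0] := posnP j.
  subst j; rewrite /patch_margin -ik' eqxx orbT ei /right_nbr /left_nbr iSk i0 /=.
  have [c0|c0] := eqVneq (c %% 3) 0.
    apply: (@leq_trans 2); last by rewrite ?c0; lia.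
    rewrite ?c0 /= add1n ltnS.
    apply: (demand_missing_one (y := (i + 1) %% 3)); first by rewrite own0.
    apply: cov3 => x /= -[xE|xE].
      by rewrite (@patched_covers true c k i.-1) ?orbT //; lia.
    by rewrite (@patched_covers false) ?orbT //; lia.
  rewrite demand_covered ?own0 => [|x x3].
    by case: (c %% 3 == 1); lia.
  have [E|[E|E]] : x = (i + 0) %% 3 \/ x = (i + c) %% 3 \/
      x <> (i + 0) %% 3 /\ x <> (i + c) %% 3 by lia.
  - by rewrite (@patched_covers false) ?orbT // addn0 ei.
  - by rewrite (@patched_covers0 false) ?orbT // ik' eqxx orbT.
  have [c2|c2] := eqVneq (c %% 3) 2.
    by rewrite (@patched_covers0 true) ?c2 ?orbT //; lia.
  by rewrite (@patched_covers true c k i.-1 0) ?orbT //; lia.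
rewrite ej /=; apply: (@leq_trans 2); last by lia.
rewrite add1n ltnS; apply: (demand_missing_one (y := (i + j + 1) %% 3)); first by rewrite own0.
apply: cov3 => x; rewrite /left_nbr i0 /= => -[xE|xE].
  by rewrite (@patched_covers true c k i.-1) ?orbT //; lia.
by rewrite (@patched_covers false) ?orbT //; lia.
Qed.

Lemma patched_bound (c k : nat) :
  k %% 6 = 3 -> 3 <= c -> ~~ odd c ->
  rainbow_dom_number (petersen (c * k) k) 3 + 2 <= c * k + c + k.
Proof.
move=> k6 c3 ec; have k0 : 0 < k by lia.
have := rainbow_dom_number_margins k0 c3
  (fun i j ik jc => patched_cost k6 c3 ec ik jc).
have side : \sum_(j < c) (~~ odd j && (j != 0 :> nat) : nat) + 1 = uphalf c.
  rewrite -sum_even_odd -(prednK (ltnW (ltnW c3))) !big_ord_recl /= add0n addnC.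
  by congr (_ + _); apply: eq_bigr => j _; rewrite andbT.
have ends : \sum_(i < k) patch_margin c k i +
    \sum_(i < k) ([&& c %% 3 == 1, ~~ odd i & i != k.-1 :> nat] : nat) <= k.
  rewrite -big_split /= /patch_margin.
  have [c0|c0] := eqVneq (c %% 3) 0.
    have pick1 p : p < k -> \sum_(i < k) (i == p :> nat) = 1.
      move=> pk; rewrite -[RHS](sum_pick (fun=> 1) pk).
      by apply: eq_bigr => i _; rewrite muln1.
    rewrite c0 /=; under eq_bigr do rewrite addn0.
    by rewrite big_split /= !pick1; lia.
  rewrite -[leqRHS]card_ord -sum1_card leq_sum // => i _.
  by case: eqP => //=; case: (odd i); case: (i == k.-1 :> nat).
move=> /= bound; move: side ends bound.
(* the sums agree only up to conversion, which [lia] does not see *)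
by do 3![move: (bigop _ _ _) => ?]; lia.
Qed.

(** * The bounds *)

Lemma three_rainbow_upper (c k : nat) :
  0 < k -> 3 <= c ->
  rainbow_dom_number (petersen (c * k) k) 3 + 3 <= c.+1 * k.+1.
Proof.
move=> k0 c3; rewrite mulnS mulSn addnC (addnC k).
have [k6|k6] : k %% 6 = 1 \/ k %% 6 = 5 \/ ~~ odd k \/ k %% 6 = 3 by lia.
  by have := stripes_bound k0 c3 (or_introl k6); case: (_ != 0); lia.
case: k6 => [k6|k6].
  by have := stripes_bound k0 c3 (or_intror k6); case: (_ != 0); lia.
have [kc|kc] := boolP (~~ odd k || odd c).
  have k1 : 1 < k by lia.
  by have := filled_bound k1 c3 kc; lia.
have k63 : k %% 6 = 3 by lia.
have ec : ~~ odd c by lia.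
by have := patched_bound k63 c3 ec; lia.
Qed.

Lemma petersen_rainbow_lower (c k t : nat) :
  t < 6 -> 0 < k -> 3 <= c ->
  t * (c * k) <= 3 * rainbow_dom_number (petersen (c * k) k) t.
Proof.
move=> t6 k0 c3; have kn : 2 * k < c * k by rewrite ltn_pmul2r.
have [g gP <-] := (rainbow_dom_number_min (petersen (c * k) k) t).1.
have := cubic_lower t6 (petersen_cubic k0 kn) gP.
by rewrite card_sum card_ord; lia.
Qed.

Lemma petersen_rainbow_eq (c k t : nat) :
  3 <= t < 6 -> 0 < k -> 3 <= c ->
  3 * rainbow_dom_number (petersen (c * k) k) t = t * (c * k) <->
  c %% 6 = 0 /\ (k %% 6 = 1 \/ k %% 6 = 5).
Proof.
case/andP=> t3 t6 k0 c3; split=> [E|[c6 k6]].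
  have [g gP gE] := (rainbow_dom_number_min (petersen (c * k) k) t).1.
  apply: (petersen_tight _ k0 c3 gP); first by lia.
  by rewrite gE card_sum card_ord; lia.
apply/eqP; rewrite eqn_leq petersen_rainbow_lower // andbT.
apply: leq_trans (rainbow_dom_number_scale _ t3) _.
rewrite leq_mul2l; apply/orP; right.
by have := stripes_bound k0 c3 k6; rewrite c6 addn0.
Qed.

Unset Implicit Arguments.
Local Open Scope ring_scope.

Theorem theorem2 (t c k : nat) (ht : t = 3%N \/ t = 4%N \/ t = 5%N)
    (hk : (1 <= k)%N) (hc : (3 <= c)%N) :
  let gamma : rat := (rainbow_dom_number (petersen (c * k) k) t)%:R in
  (t%:R / 3%:R * (c%:R * k%:R) <= gamma
     <= t%:R / 3%:R * ((c%:R + 1) * (k%:R + 1)) - t%:R) /\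
  (gamma = t%:R / 3%:R * (c%:R * k%:R) <->
     (c = 0 %[mod 6])%N /\ ((k = 1 %[mod 6])%N \/ (k = 5 %[mod 6])%N)).
Proof.
move=> gamma.
have t36 : (3 <= t < 6)%N by lia.
have [t3 t6] := andP t36.
have lower := petersen_rainbow_lower t6 hk hc.
have upper := leq_mul (leqnn t) (three_rainbow_upper hk hc).
have scale := rainbow_dom_number_scale (petersen (c * k) k) t3.
have gammaE x : (gamma == (x%:R / 3%:R)) =
    (3 * rainbow_dom_number (petersen (c * k) k) t == x)%N.
  by rewrite -(inj_eq (mulIf (_ : 3%:R != 0))) // divfK // -natrM eqr_nat mulnC.
have lowE : t%:R / 3%:R * (c%:R * k%:R) = (t * (c * k))%:R / 3%:R :> rat.
  by rewrite !natrM mulrAC.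
split; last first.
  rewrite lowE; rewrite -(petersen_rainbow_eq t36 hk hc).
  split=> [/eqP|E]; first by rewrite gammaE => /eqP.
  by apply/eqP; rewrite gammaE E.
apply/andP; split.
  by rewrite lowE ler_pdivrMr // -natrM ler_nat; lia.
rewrite lerBrDr mulrAC ler_pdivlMr // !natr1 -!natrM -natrD -natrM ler_nat.
lia.
Qed.
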